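(* For all positive integers $n$ and non-negative integers $k$, with $n_1$ denoting a non-negative integer and $Q_m:=\dfrac{y^{(k+1)m}-x^{(k+1)m}}{y^{k+1}-x^{k+1}}$ (a polynomial in $x,y$), $$\det_{0\le i,j\le n-1}\Big(\sum_{l\ge0}\mathcal P^+_{i+j+1}(k,l)\Big)= \begin{cases} (-1)^{n_1\binom{k+1}2}(xy)^{(k+1)^2\binom{n_1+1}2-n}\big(Q_{n_1+1}+(-1)^kQ_{n_1}\big), & \text{if } n=(k+1)n_1,\\ (-1)^{n_1\binom{k+1}2}(xy)^{(k+1)^2\binom{n_1+1}2}(1+x)(1+y)\,Q_{n_1+1}, & \text{if } n=(k+1)n_1+1,\\ (-1)^{(n_1+1)\binom{k+1}2+k}(xy)^{(k+1)^2\binom{n_1+1}2+(k^2-1)(n_1+1)}(1+x)(1+y)\,Q_{n_1+1}, & \text{if } n=(k+1)n_1+k,\\ 0, & \text{if } n\not\equiv 0,1,k \pmod{k+1}. \end{cases}$$ For $k=0$ only the first case applies, and for $k=1$ only the first two cases apply.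
   Context: Three-step paths consist of up-steps $(1,1)$, level steps $(1,0)$ and down-steps $(1,-1)$. Weights: $w((1,1))=1$, $w((1,0))=x+y$, $w((1,-1))=xy$, and the weight $w(P)$ of a path is the product of the weights of its steps. $\mathcal P_n(k,l)=\sum_P w(P)$ over all three-step paths from $(0,k)$ to $(n,l)$; $\mathcal P^+_n(k,l)$ is the same sum restricted to paths that never run below the $x$-axis. For fixed $n,k$ the sum $\sum_{l\ge0}\mathcal P^+_n(k,l)$ is finite. These are polynomials in the indeterminates $x,y$. *)

(* Defs.v *)
From HB Require Import structures.
From mathcomp Require Import all_boot all_order all_algebra.
Set Implicit Arguments. Unset Strict Implicit. Unset Printing Implicit Defensive.
Import Order.TTheory GRing.Theory Num.Theory.
Local Open Scope ring_scope.

(* Steps of a three-step path, encoded in the finType [option bool]: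
   Some true = up-step (1,1), None = level step (1,0), Some false = down-step (1,-1). *)
Definition step := option bool.

Definition incr (s : step) : int :=
  match s with Some true => 1 | None => 0 | Some false => -1 end.

Definition wstep (R : comRingType) (x y : R) (s : step) : R :=
  match s with Some true => 1 | None => x + y | Some false => x * y end.

Definition heights (k : nat) (p : seq step) : seq int :=
  scanl (fun h s => h + incr s) (k%:Z) p.

Definition endheight (k : nat) (p : seq step) : int := last (k%:Z) (heights k p).

Definition nonneg_path (k : nat) (p : seq step) : bool :=
  all (fun h => 0 <= h) (heights k p).

Definition Pplus (R : comRingType) (x y : R) (n k l : nat) : R :=
  \sum_(p : n.-tuple step | nonneg_path k p && (endheight k p == l%:Z))
     \prod_(s <- p) wstep x y s.

(* sum_{l >= 0} P^+_n(k,l); endpoints satisfy l <= k + n, so the sum is over l < k+n+1 *)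
Definition Pplus_total (R : comRingType) (x y : R) (n k : nat) : R :=
  \sum_(l < k + n + 1) Pplus x y n k l.

(* Q_m = (y^{(k+1)m} - x^{(k+1)m}) / (y^{k+1} - x^{k+1}), written as the quotient polynomial *)
Definition Qpoly (R : comRingType) (x y : R) (k m : nat) : R :=
  \sum_(j < m) y ^+ ((k + 1) * j) * x ^+ ((k + 1) * (m - 1 - j)).

Definition Zxy := {poly {poly int}}.
Definition xv : Zxy := 'X.
Definition yv : Zxy := ('X)%:P.

Definition hankel_det (n k : nat) : Zxy :=
  \det (\matrix_(i < n, j < n) Pplus_total xv yv (i + j + 1) k).

(* Main.v *)
Require Import Defs.
From HB Require Import structures.
From mathcomp Require Import all_boot all_order all_algebra.
From mathcomp Require Import perm zify ring.
Set Implicit Arguments.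
Unset Strict Implicit.
Unset Printing Implicit Defensive.
Import Order.TTheory GRing.Theory.
Import Pdiv.CommonRing Pdiv.RingMonic.
Local Open Scope ring_scope.

(** Write [sigma = (1 + x)(1 + y)], let [L] be the linear functional on
    polynomials whose moments are the path totals started at height 0, and let
    [cheb] be the Lucas sequence with parameters ['X - (x + y)] and [x y], that
    is, a shifted Chebyshev polynomial.  The recurrence for the path totals says
    that [L ('X^m * cheb k.+1)] is the total of length [m] started at height
    [k].  A path shorter than its starting height cannot cross the axis, so
    [L (f * cheb a) = f.[sigma]] when [size f <= a]; this makes differences of
    [cheb]s of large index, and multiples of [('X - sigma) * cheb a],
    [L]-orthogonal to polynomials of small degree.

    The theorem is about the Hankel determinant of the weight ['X * cheb k.+1]
    with respect to [L].  By Christoffel's formula it reduces to a determinant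
    of size [k.+1], made of the residues modulo ['X * cheb k.+1] of monic
    polynomials of degrees [n, ..., n + k] orthogonal to all polynomials of
    degree less than [n].  As [cheb k.+1] divides [cheb (k.+1 * m)], with a
    quotient equal to [Q_m] at 0 up to sign, one of them can be chosen divisible
    by [cheb k.+1]: [cheb (n + k.+1) - cheb n] if [k.+1] divides [n], otherwise
    [('X - sigma) * cheb (k.+1 * m.+1)] or, when [n] is not congruent to 0, 1
    or [k], even ['X] times it, whose residue is 0.  The other residues are
    periodic up to sign and powers of [x y], by the reflection
    [cheb (a + m) = - (x y)^m cheb (a - m)] modulo [cheb a]. *)

Lemma bin2D m n : 'C(m + n, 2) = ('C(m, 2) + 'C(n, 2) + m * n)%N.
Proof.
elim: m => [|m IHm]; first by rewrite mul0n addn0.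
by rewrite addSn !binS !bin1 IHm; lia.
Qed.

Lemma bin2M m n : 'C(m * n, 2) = (m ^ 2 * 'C(n, 2) + n * 'C(m, 2))%N.
Proof.
elim: n => [|n IHn]; first by rewrite muln0 bin0n muln0.
by rewrite mulnS bin2D IHn binS bin1; ring.
Qed.

Lemma bin2S_double n : ('C(n.+1, 2) * 2 = n.+1 * n)%N.
Proof. by rewrite mulnC mul_bin_left subn1 bin1 mulnC. Qed.

Lemma eq_signr (R : nzRingType) a b :
  odd a = odd b -> (-1) ^+ a = (-1) ^+ b :> R.
Proof. by move=> eq_odd; rewrite -signr_odd eq_odd signr_odd. Qed.

Lemma big_tuple_recl (A : Type) (idx : A) (op : Monoid.com_law idx)
    (T : finType) n (P : pred (seq T)) (F : seq T -> A) :
  \big[op/idx]_(p : n.+1.-tuple T | P p) F p =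
  \big[op/idx]_s \big[op/idx]_(p : n.-tuple T | P (s :: p)) F (s :: p).
Proof.
rewrite pair_big_dep /=.
rewrite (reindex (fun sp : T * n.-tuple T => cons_tuple sp.1 sp.2)) //=.
exists (fun p => (thead p, behead_tuple p)) => [[s p] _|p _] /=.
  by congr pair; apply: val_inj.
by rewrite [RHS]tuple_eta; apply: val_inj.
Qed.

Section Lucas.
Variables (A : comNzRingType) (s p : A).

Fixpoint lucas_from (u0 u1 : A) (m : nat) : A :=
  if m is m'.+1 then lucas_from u1 (s * u1 - p * u0) m' else u0.

Lemma lucas_fromSS u0 u1 m :
  lucas_from u0 u1 m.+2 = s * lucas_from u0 u1 m.+1 - p * lucas_from u0 u1 m.
Proof. by elim: m u0 u1 => [|m IHm] u0 u1 //; rewrite [LHS]IHm. Qed.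

Lemma lucas_from_unique (u : nat -> A) m :
  (forall i, u i.+2 = s * u i.+1 - p * u i) ->
  u m = lucas_from (u 0) (u 1) m.
Proof.
move=> uSS; suff [] : u m = lucas_from (u 0) (u 1) m /\
                      u m.+1 = lucas_from (u 0) (u 1) m.+1 by [].
by elim: m => [|m [IHm IHmS]] //; rewrite uSS lucas_fromSS IHm IHmS.
Qed.

Lemma lucas_fromM a u0 u1 m :
  lucas_from (a * u0) (a * u1) m = a * lucas_from u0 u1 m.
Proof.
rewrite -(@lucas_from_unique (fun i => a * lucas_from u0 u1 i)) // => i.
by rewrite lucas_fromSS; ring.
Qed.

Definition lucasU := lucas_from 0 1.
Definition lucasV := lucas_from 2 s.

Lemma lucasUSS m : lucasU m.+2 = s * lucasU m.+1 - p * lucasU m.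
Proof. exact: lucas_fromSS. Qed.

Lemma lucasVSS m : lucasV m.+2 = s * lucasV m.+1 - p * lucasV m.
Proof. exact: lucas_fromSS. Qed.

Lemma lucasU_reflect m b :
  lucasU (m + m + b) + p ^+ m * lucasU b = lucasV m * lucasU (m + b).
Proof.
elim/ltn_ind: m b => -[|[|m]] IHm b.
- by rewrite mul1r -[lucasV 0]/2%R; ring.
- by rewrite !addSn !add0n lucasUSS -[lucasV 1]/s; ring.
have := IHm m.+1 (ltnSn _) b.+1; have := IHm m (leqnSn _) b.+2.
rewrite !(addSn, addnS) => IHmb IHmSb.
rewrite lucasVSS mulrBl -![in RHS]mulrA -IHmb -IHmSb.
by rewrite (lucasUSS b) (lucasUSS (m + m + b).+2) !exprS; ring.
Qed.

End Lucas.

Lemma lucasU_mul (A : comNzRingType) (s p : A) d n :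
  lucasU s p (d * n) = lucasU (lucasV s p d) (p ^+ d) n * lucasU s p d.
Proof.
rewrite mulrC /lucasU -lucas_fromM -/(lucasU s p) mulr0 mulr1.
rewrite (@lucas_from_unique _ (lucasV s p d) (p ^+ d)
           (fun n => lucasU s p (d * n))).
  by rewrite muln0 muln1.
move=> i; apply/eqP; rewrite eq_sym subr_eq !mulnS addnA; apply/eqP.
by rewrite lucasU_reflect.
Qed.

Lemma rmorph_lucas_from (A B : comNzRingType) (f : {rmorphism A -> B})
    s p u0 u1 m :
  f (lucas_from s p u0 u1 m) = lucas_from (f s) (f p) (f u0) (f u1) m.
Proof.
by elim: m u0 u1 => [|m IHm] u0 u1 //=; rewrite IHm rmorphB !rmorphM.
Qed.

Lemma rmorph_lucasU (A B : comNzRingType) (f : {rmorphism A -> B}) s p m :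
  f (lucasU s p m) = lucasU (f s) (f p) m.
Proof. by rewrite /lucasU rmorph_lucas_from rmorph0 rmorph1. Qed.

Lemma rmorph_lucasV (A B : comNzRingType) (f : {rmorphism A -> B}) s p m :
  f (lucasV s p m) = lucasV (f s) (f p) m.
Proof. by rewrite /lucasV rmorph_lucas_from rmorph_nat. Qed.

Lemma lucas_from_homog (A : comNzRingType) (a s p u0 u1 : A) m :
  lucas_from (a * s) (a ^+ 2 * p) u0 (a * u1) m =
  a ^+ m * lucas_from s p u0 u1 m.
Proof.
rewrite (@lucas_from_unique _ (a * s) (a ^+ 2 * p)
           (fun i => a ^+ i * lucas_from s p u0 u1 i)); first by rewrite mul1r.
by move=> i; rewrite lucas_fromSS !exprS; ring.
Qed.

Lemma lucasU_homog (A : comNzRingType) (a s p : A) m :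
  lucasU (a * s) (a ^+ 2 * p) m.+1 = a ^+ m * lucasU s p m.+1.
Proof. by rewrite /lucasU /= !mulr0 !subr0 !mulr1 lucas_from_homog. Qed.

Lemma lucasV_homog (A : comNzRingType) (a s p : A) m :
  lucasV (a * s) (a ^+ 2 * p) m = a ^+ m * lucasV s p m.
Proof. exact: lucas_from_homog. Qed.

Lemma lucasV_sum_prod (A : comNzRingType) (x y : A) m :
  lucasV (x + y) (x * y) m = x ^+ m + y ^+ m.
Proof.
rewrite [RHS](@lucas_from_unique _ (x + y) (x * y)
                (fun i => x ^+ i + y ^+ i)) //.
by move=> i; rewrite !exprS; ring.
Qed.

Lemma lucasU_sum_prod (A : comNzRingType) (x y : A) m :
  lucasU (x + y) (x * y) m = \sum_(j < m) y ^+ j * x ^+ (m - 1 - j).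
Proof.
pose h n := \sum_(j < n) y ^+ j * x ^+ (n - 1 - j).
have hS n : h n.+1 = x * h n + y ^+ n.
  rewrite /h big_ord_recr big_distrr /= subSS subn0 subnn mulr1.
  congr (_ + _); apply: eq_bigr => j _; rewrite mulrCA -exprS.
  by congr (_ * x ^+ _); have := ltn_ord j; lia.
have h0 : h 0 = 0 by rewrite /h big_ord0.
rewrite -/(h m) (@lucas_from_unique _ (x + y) (x * y) h) => [|i].
  by rewrite hS h0 mulr0 add0r.
have -> : h i.+2 = (x + y) * h i.+1 - y * h i.+1 + y * y ^+ i.
  by rewrite hS exprS; ring.
by rewrite [in y * h i.+1]hS; ring.
Qed.

Section PathTotals.
Variables (R : comNzRingType) (x y : R).

Lemma endheight_ge0 k (p : seq step) : nonneg_path k p -> 0 <= endheight k p.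
Proof.
move=> /allP heights_ge0; have := mem_last k%:Z (heights k p).
by rewrite inE /endheight => /predU1P[-> //|/heights_ge0].
Qed.

Lemma endheight_le k (p : seq step) : endheight k p <= (k + size p)%:Z.
Proof.
rewrite /endheight /heights PoszD.
elim: p k%:Z => [|s p IHp] h /=; first by lia.
by apply: (le_trans (IHp _)); case: s => [[]|] /=; lia.
Qed.

Lemma Pplus_totalE n k : Pplus_total x y n k =
  \sum_(p : n.-tuple step | nonneg_path k p) \prod_(s <- p) wstep x y s.
Proof.
pose end_ord (p : n.-tuple step) : 'I_(k + n).+1 := inord `|endheight k p|%N.
rewrite [RHS](partition_big end_ord predT) //= /Pplus_total addn1.
apply: eq_bigr => l _; apply: eq_bigl => p.
case: (boolP (nonneg_path k p)) => //= p_nonneg.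
have := endheight_ge0 p_nonneg; have := endheight_le k p.
rewrite size_tuple /end_ord.
case: (endheight k p) => // e le_e _.
by rewrite -val_eqE /= inordK.
Qed.

Lemma big_step (F : step -> R) :
  \sum_s F s = F (Some true) + F None + F (Some false).
Proof.
rewrite (bigD1 (Some true)) // (bigD1 None) // (bigD1 (Some false)) //=.
by rewrite big1 ?addr0 ?addrA // => -[[]|].
Qed.

Lemma Pplus_total0 k : Pplus_total x y 0 k = 1.
Proof.
rewrite Pplus_totalE (eq_bigl predT) => [|p]; last by rewrite tuple0.
rewrite (eq_bigr (fun=> 1)) => [|p _]; last by rewrite tuple0 big_nil.
by rewrite sumr_const card_tuple.
Qed.

Lemma Pplus_totalS n k : Pplus_total x y n.+1 k =
  Pplus_total x y n k.+1 + (x + y) * Pplus_total x y n k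
  + (if k is k'.+1 then x * y * Pplus_total x y n k' else 0).
Proof.
rewrite Pplus_totalE (big_tuple_recl _ _ (nonneg_path k)
  (fun p => \prod_(s <- p) wstep x y s)) big_step.
have first_step s k' : (k%:Z + incr s = k'%:Z)%R ->
    \sum_(p : n.-tuple step | nonneg_path k (s :: p))
       \prod_(s <- s :: p) wstep x y s = wstep x y s * Pplus_total x y n k'.
  move=> heightE; rewrite Pplus_totalE big_distrr /=; apply: eq_big => p.
    by rewrite /nonneg_path /heights /= heightE.
  by move=> _; rewrite big_cons.
rewrite (first_step _ k.+1) /=; last by lia.
rewrite (first_step _ k) /=; last by lia.
rewrite mul1r; congr (_ + _).
case: k first_step => [|k] first_step; first by rewrite big_pred0.
by rewrite (first_step _ k) //=; lia.
Qed.

Lemma Pplus_total_high n k : (n <= k)%N ->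
  Pplus_total x y n k = ((1 + x) * (1 + y)) ^+ n.
Proof.
elim: n k => [|n IHn] [|k] // le_nk; rewrite ?Pplus_total0 //.
by rewrite Pplus_totalS !IHn; [rewrite exprS; ring | lia..].
Qed.

Lemma Pplus_total_diag k :
  Pplus_total x y k.+1 k = ((1 + x) * (1 + y)) ^+ k.+1 - (x * y) ^+ k.+1.
Proof.
elim: k => [|k IHk]; first by rewrite Pplus_totalS !Pplus_total0; ring.
by rewrite Pplus_totalS IHk !Pplus_total_high // !exprS; ring.
Qed.

End PathTotals.

Section Determinants.
Variable R : comNzRingType.
Implicit Type c : nat -> nat -> R.

Lemma odd_perm_rev_ord n : odd_perm (perm (@rev_ord_inj n)) = odd 'C(n, 2).
Proof.
elim: n => [|n IHn].
  by rewrite (_ : perm _ = 1%g) ?odd_perm1 //; apply/permP => -[].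
rewrite binS bin1 oddD -IHn.
suff -> : perm (@rev_ord_inj n.+1)
    = lift_perm ord0 ord_max (perm (@rev_ord_inj n)).
  by rewrite odd_lift_perm /= addbC.
apply/permP => i; rewrite permE; case: (unliftP ord0 i) => [j ->|->].
  rewrite lift_perm_lift permE; apply: val_inj => /=.
  by rewrite /bump /=; case: j => j /= j_lt; lia.
by rewrite lift_perm_id; apply: val_inj; rewrite /= subSS subn0.
Qed.

Lemma det_reverse_rows n c :
  \det (\matrix_(i < n, j < n) c (n - i.+1)%N j) =
  (-1) ^+ 'C(n, 2) * \det (\matrix_(i < n, j < n) c i j).
Proof.
rewrite -signr_odd -odd_perm_rev_ord -det_perm -det_mulmx -row_permE.
by congr (\det _); apply/matrixP => i j; rewrite !mxE permE.
Qed.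

Lemma det_scale_rows n (s : nat -> R) c :
  \det (\matrix_(i < n, j < n) (s i * c i j)) =
  (\prod_(i < n) s i) * \det (\matrix_(i < n, j < n) c i j).
Proof.
have -> : \prod_(i < n) s i = \det (diag_mx (\row_(i < n) s i)).
  by rewrite det_diag; apply: eq_bigr => i _; rewrite mxE.
rewrite -det_mulmx mul_diag_mx.
by congr (\det _); apply/matrixP => i j; rewrite !mxE.
Qed.

Lemma det_antiblock d n c :
  (forall i j, (i < d)%N -> (j < n)%N -> c (n + i)%N (d + j)%N = 0) ->
  \det (\matrix_(i < d + n, j < d + n) c i j) =
  (-1) ^+ (d * n) * \det (\matrix_(i < n, j < n) c i (d + j)%N)
                  * \det (\matrix_(i < d, j < d) c (n + i)%N j).
Proof.
move=> c0; set M := \matrix_(i < d + n, j < d + n) c i j.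
apply: (@lreg_sign _ 'C(d + n, 2)).
rewrite -det_reverse_rows; set M' := (X in \det X).
have -> : M' = block_mx
    (\matrix_(i < d, j < d) c (n + (d - i.+1))%N j) 0
    (dlsubmx M') (\matrix_(i < n, j < n) c (n - i.+1)%N (d + j)%N).
  rewrite -[LHS]submxK; congr block_mx; apply/matrixP => i j; rewrite !mxE /=.
  - by congr c; have := ltn_ord i; lia.
  - by rewrite -(c0 (d - i.+1)%N j) //; [congr c|]; have := ltn_ord i; lia.
  by congr c; lia.
rewrite det_lblock (det_reverse_rows d (fun i => c (n + i)%N)).
rewrite (det_reverse_rows n (fun i j => c i (d + j)%N)).
rewrite bin2D !exprD; have := sqrr_sign R (d * n).
by rewrite expr2 => sgn2; ring: sgn2.
Qed.

Lemma det_telescope_rows n c : (forall j, c n j = 0) ->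
  \det (\matrix_(i < n, j < n) (c i.+1 j - c i j)) =
  (-1) ^+ n * \det (\matrix_(i < n, j < n) c i j).
Proof.
move=> cn0.
have <- : \det (\matrix_(i < n, l < n) ((l == i.+1 :> nat)%:R - (l == i)%:R))
    = (-1) ^+ n :> R.
  rewrite -det_tr det_trig; last first.
    apply/is_trig_mxP => i j lt_ij; rewrite !mxE.
    by rewrite -val_eqE /= !ltn_eqF ?subr0 //; lia.
  rewrite -[RHS]mulr1 -[in RHS](card_ord n) -prodr_const mulr1.
  by apply: eq_bigr => i _; rewrite !mxE eqxx ltn_eqF ?ltnSn // sub0r.
rewrite -det_mulmx; congr (\det _); apply/matrixP => i j; rewrite !mxE.
under eq_bigr do rewrite !mxE mulrBl.
rewrite sumrB; congr (_ - _); last first.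
  rewrite (bigD1 i) //= eqxx mul1r big1 ?addr0 // => l ne.
  by rewrite (negPf ne) mul0r.
have [lt_in|ge_in] := ltnP i.+1 n.
  rewrite (bigD1 (Ordinal lt_in)) //= eqxx mul1r big1 ?addr0 // => l.
  by rewrite -val_eqE /= => /negPf->; rewrite mul0r.
have -> : i.+1 = n by have := ltn_ord i; lia.
rewrite cn0 big1 // => l _.
by rewrite ltn_eqF ?mul0r // (leq_trans (ltn_ord l)).
Qed.

End Determinants.

Section MonicOfDegree.
Variable R : comNzRingType.
Implicit Types (f g : {poly R}) (b : nat -> {poly R}).

Definition monic_of_degree d f := (f \is monic) && (size f == d.+1).

Lemma monic_of_degreeXn d : monic_of_degree d ('X^d : {poly R}).
Proof. by rewrite /monic_of_degree monicXn size_polyXn eqxx. Qed.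

Lemma monic_of_degreeXsubC a : monic_of_degree 1 ('X - a%:P).
Proof. by rewrite /monic_of_degree monicXsubC size_XsubC eqxx. Qed.

Lemma monic_of_degreeM d e f g :
  monic_of_degree d f -> monic_of_degree e g -> monic_of_degree (d + e) (f * g).
Proof.
move=> /andP[f_monic /eqP f_size] /andP[g_monic /eqP g_size].
rewrite /monic_of_degree monicMl ?g_monic //=.
by rewrite size_monicM ?monic_neq0 // f_size g_size addnS.
Qed.

Lemma monic_of_degreeD d f g :
  monic_of_degree d f -> (size g <= d)%N -> monic_of_degree d (f + g).
Proof.
move=> /andP[f_monic /eqP f_size] g_size.
have lt : (size g < size f)%N by rewrite f_size.
rewrite /monic_of_degree monicE lead_coefDl // -monicE f_monic.
by rewrite size_polyDl ?f_size /=.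
Qed.

Definition Xn_cat n b l := if (l < n)%N then 'X^l else b (l - n)%N.

Lemma Xn_cat_lt n b l : (l < n)%N -> Xn_cat n b l = 'X^l.
Proof. by rewrite /Xn_cat => ->. Qed.

Lemma Xn_cat_addn n b i : Xn_cat n b (n + i) = b i.
Proof. by rewrite /Xn_cat ltnNge leq_addr addKn. Qed.

Lemma monic_of_degree_Xn_cat n d b :
  (forall i, (i < d)%N -> monic_of_degree (n + i) (b i)) ->
  forall l, (l < n + d)%N -> monic_of_degree l (Xn_cat n b l).
Proof.
move=> b_monic l lt_l; have [lt_ln|le_nl] := ltnP l n.
  by rewrite Xn_cat_lt ?monic_of_degreeXn.
by rewrite -(subnKC le_nl) Xn_cat_addn b_monic // ltn_subLR.
Qed.

Lemma det_monic_coefs n b : (forall l, (l < n)%N -> monic_of_degree l (b l)) ->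
  \det (\matrix_(l < n, i < n) (b l)`_i) = 1.
Proof.
move=> b_monic; rewrite det_trig.
  rewrite big1 // => i _; rewrite mxE.
  have /andP[/monicP b_lead /eqP b_size] := b_monic _ (ltn_ord i).
  by rewrite /lead_coef b_size in b_lead.
apply/is_trig_mxP => i j lt_ij; rewrite mxE nth_default //.
by have /andP[_ /eqP->] := b_monic _ (ltn_ord i).
Qed.

Lemma poly_sum_coefs n f : (size f <= n)%N -> f = \sum_(i < n) f`_i *: 'X^i.
Proof. by move=> le_n; rewrite -poly_def -/(take_poly n f) take_poly_id. Qed.

Lemma scalar_sum_coefs (F : {poly R} -> R) n f : scalar F -> (size f <= n)%N ->
  F f = \sum_(i < n) f`_i * F 'X^i.
Proof.
move=> F_lin /poly_sum_coefs {1}->.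
have F0 : F 0 = 0 by have := F_lin (-1) 0 0; rewrite scaler0 addr0 mulN1r addNr.
by elim/big_rec2: _ => [|i u v _ <-] //; apply: F_lin.
Qed.

Lemma det_monic_basis n (F : nat -> {poly R} -> R) b :
  (forall j, scalar (F j)) ->
  (forall l, (l < n)%N -> monic_of_degree l (b l)) ->
  \det (\matrix_(l < n, j < n) F j (b l)) =
  \det (\matrix_(l < n, j < n) F j 'X^l).
Proof.
move=> F_lin b_monic; rewrite -[RHS]mul1r -(det_monic_coefs b_monic).
rewrite -det_mulmx; congr (\det _); apply/matrixP => l j; rewrite !mxE.
rewrite (@scalar_sum_coefs _ n) //.
  by apply: eq_bigr => i _; rewrite !mxE.
by have /andP[_ /eqP->] := b_monic _ (ltn_ord l).
Qed.

End MonicOfDegree.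

Section Hankel.
Variable R : comNzRingType.

Definition hankel n (mu : nat -> R) : 'M[R]_n :=
  \matrix_(i < n, j < n) mu (i + j)%N.

Definition moment_functional (mu : nat -> R) (f : {poly R}) : R :=
  \sum_(i < size f) f`_i * mu i.

Lemma moment_functionalE mu n (f : {poly R}) : (size f <= n)%N ->
  moment_functional mu f = \sum_(i < n) f`_i * mu i.
Proof.
move=> le_n; rewrite /moment_functional.
rewrite (big_ord_widen n (fun i => f`_i * mu i)) // big_mkcond.
apply: eq_bigr => i _; case: ltnP => // le_i.
by rewrite nth_default ?mul0r.
Qed.

Lemma moment_functional_is_scalar mu : scalar (moment_functional mu).
Proof.
move=> a f g; pose n := maxn (size f) (size g).
have le_n : (size (a *: f + g)%R <= n)%N.
  rewrite (leq_trans (size_polyD _ _)) // geq_max leq_maxr andbT.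
  by rewrite (leq_trans (size_scale_leq _ _)) ?leq_maxl.
rewrite !(@moment_functionalE _ n) ?leq_maxl ?leq_maxr // big_distrr -big_split.
by apply: eq_bigr => i _ /=; rewrite coefD coefZ mulrDl mulrA.
Qed.

HB.instance Definition _ mu := GRing.isLinear.Build R {poly R} R *%R
  (moment_functional mu) (@moment_functional_is_scalar mu).

Lemma moment_functionalXn mu n : moment_functional mu 'X^n = mu n.
Proof.
rewrite (@moment_functionalE _ n.+1) ?size_polyXn // big_ord_recr /= coefXn.
by rewrite eqxx mul1r big1 ?add0r // => i _; rewrite coefXn ltn_eqF ?mul0r.
Qed.

Variable L : {scalar {poly R}}.
Implicit Types (f W : {poly R}) (b p : nat -> {poly R}).

Definition orthogonal_below n f := forall j, (j < n)%N -> L ('X^j * f) = 0.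

Definition monic_orthogonal n d f :=
  monic_of_degree d f /\ orthogonal_below n f.

Lemma scalar_mul_Xn j : scalar (fun f => L ('X^j * f)).
Proof. by move=> a f g; rewrite mulrDr -scalerAr linearP. Qed.

Lemma det_hankel_orthogonal n p :
  (forall l, (l < n)%N -> monic_orthogonal l l (p l)) ->
  \det (hankel n (fun m => L 'X^m)) = \prod_(l < n) L ('X^l * p l).
Proof.
move=> p_mon_orth.
have p_monic l (lt_ln : (l < n)%N) := (p_mon_orth l lt_ln).1.
have -> : hankel n (fun m => L 'X^m) = \matrix_(l < n, j < n) L ('X^j * 'X^l).
  by apply/matrixP => i j; rewrite !mxE -exprD addnC.
rewrite -(det_monic_basis scalar_mul_Xn p_monic) -det_tr det_trig.
  by apply: eq_bigr => l _; rewrite !mxE.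
by apply/is_trig_mxP => i j lt_ij; rewrite !mxE (p_mon_orth j _).2.
Qed.

(* Both sides are the determinant of the functionals [lambda j], for [j < d],
   and [f |-> L ('X^j * f)], for [j < n]: on the left in the monic basis
   [1, ..., 'X^d.-1, W, 'X * W, ...], on the right in the monic basis
   [1, ..., 'X^n.-1, b 0, ..., b d.-1]. *)
Lemma det_hankel_christoffel n d W (lambda : nat -> {poly R} -> R) b :
  monic_of_degree d W ->
  (forall j, scalar (lambda j)) -> (forall j g, lambda j (g * W) = 0) ->
  (forall i, (i < d)%N -> monic_orthogonal n (n + i) (b i)) ->
  \det (\matrix_(i < d, j < d) lambda j 'X^i) *
    \det (hankel n (fun m => L ('X^m * W))) =
  (-1) ^+ (d * n) * \det (hankel n (fun m => L 'X^m)) *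
    \det (\matrix_(i < d, j < d) lambda j (b i)).
Proof.
move=> W_monic lambda_lin lambdaW b_mon_orth.
pose F j f := if (j < d)%N then lambda j f else L ('X^(j - d) * f).
have F_lin j : scalar (F j).
  move=> a f g; rewrite /F; case: ifP => _; first exact: lambda_lin.
  exact: scalar_mul_Xn.
have F_lt (j : 'I_d) f : F j f = lambda j f by rewrite /F ltn_ord.
have F_ge j f : F (d + j)%N f = L ('X^j * f).
  by rewrite /F ltnNge leq_addr addKn.
pose u := Xn_cat d (fun j => 'X^j * W); pose v := Xn_cat n b.
have u_monic l : (l < d + n)%N -> monic_of_degree l (u l).
  apply: monic_of_degree_Xn_cat => i _; rewrite addnC.
  exact: monic_of_degreeM (monic_of_degreeXn _ _) W_monic.
have v_monic l : (l < d + n)%N -> monic_of_degree l (v l).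
  by rewrite addnC; apply: monic_of_degree_Xn_cat => i /b_mon_orth[].
have := etrans (det_monic_basis F_lin u_monic)
  (esym (det_monic_basis F_lin v_monic)).
rewrite (@det_antiblock _ d n (fun l j => F j (v l))); last first.
  by move=> i j lt_id lt_jn; rewrite F_ge /v Xn_cat_addn (b_mon_orth i _).2.
set M := (X in \det X = _ -> _).
have -> : M = block_mx (\matrix_(i < d, j < d) lambda j 'X^i) (ursubmx M) 0
    (hankel n (fun m => L ('X^m * W))).
  rewrite -[LHS]submxK; congr block_mx; apply/matrixP => i j; rewrite !mxE /=.
  - by rewrite F_lt /u Xn_cat_lt.
  - by rewrite F_lt /u Xn_cat_addn lambdaW.
  by rewrite F_ge /u Xn_cat_addn mulrA -exprD addnC.
rewrite det_ublock => ->.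
congr (_ * _ * _); congr (\det _); apply/matrixP => i j.
  by rewrite !mxE F_ge /v Xn_cat_lt // -exprD addnC.
by rewrite !mxE F_lt /v Xn_cat_addn.
Qed.

End Hankel.

Section ResidueCoordinates.
Variables (R : comNzRingType) (k : nat) (c : {poly R}).
Hypothesis c_monic : monic_of_degree k c.
Implicit Type g : {poly R}.

(* Coordinates on the quotient by ['X * c], chosen so that only the last one
   does not vanish on the multiples of [c]. *)
Definition residue_coord j (f : {poly R}) : R :=
  if (j < k)%N then (rmodp f c)`_j else (rmodp f ('X * c))`_k.

Definition residue_mx (b : nat -> {poly R}) : 'M[R]_k :=
  \matrix_(i < k, j < k) (rmodp (b i) c)`_j.

Lemma monic_of_degree_mulX : monic_of_degree k.+1 ('X * c).
Proof.
by rewrite -[k.+1]add1n -['X]expr1 monic_of_degreeM ?monic_of_degreeXn.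
Qed.

Lemma residue_coord_is_scalar j : scalar (residue_coord j).
Proof.
have /andP[mon_c _] := c_monic; have /andP[mon_Xc _] := monic_of_degree_mulX.
move=> a f g; rewrite /residue_coord.
by case: ifP; rewrite rmodpD ?rmodpZ // coefD coefZ.
Qed.

Lemma residue_coord_mulX j g : residue_coord j (g * ('X * c)) = 0.
Proof.
have /andP[mon_c _] := c_monic; have /andP[mon_Xc _] := monic_of_degree_mulX.
by rewrite /residue_coord [X in rmodp X c]mulrA !rmodp_mull // !coef0 if_same.
Qed.

Lemma residue_coord_mul j g :
  residue_coord j (g * c) = if (j < k)%N then 0 else g.[0].
Proof.
have /andP[mon_c /eqP size_c] := c_monic.
have /andP[mon_Xc /eqP size_Xc] := monic_of_degree_mulX.
rewrite /residue_coord rmodp_mull // coef0; congr (if _ then _ else _).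
elim/poly_ind: g => [|g a _]; first by rewrite mul0r rmod0p coef0 horner0.
rewrite mulrDl -mulrA rmodp_addl_mul_small //; last first.
  by rewrite mul_polyC size_Xc -size_c ltnS size_scale_leq.
rewrite coefCM !hornerE -[RHS]mulr1; congr (_ * _).
by move/monicP: mon_c; rewrite /lead_coef size_c.
Qed.

Lemma det_residue_coord_Xn :
  \det (\matrix_(i < k.+1, j < k.+1) residue_coord j 'X^i) = 1.
Proof.
have /andP[_ /eqP size_c] := c_monic.
have /andP[_ /eqP size_Xc] := monic_of_degree_mulX.
have coordE (i j : 'I_k.+1) : (i <= j)%N -> residue_coord j 'X^i = (i == j)%:R.
  move=> le_ij; rewrite /residue_coord -val_eqE /=; case: ltnP => [lt_jk|le_kj].
    by rewrite rmodp_small ?coefXn 1?eq_sym // size_c size_polyXn; lia.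
  have -> : val j = k by have := ltn_ord j; rewrite /=; lia.
  by rewrite rmodp_small ?coefXn 1?eq_sym // size_Xc size_polyXn ltnS.
rewrite det_trig; first by rewrite big1 // => i _; rewrite mxE coordE ?eqxx.
apply/is_trig_mxP => i j lt_ij.
by rewrite mxE coordE ?(ltnW lt_ij) // -val_eqE /= ltn_eqF.
Qed.

Lemma det_residue_coord_mul (b : nat -> {poly R}) (i0 : 'I_k.+1) g :
  b i0 = g * c ->
  \det (\matrix_(i < k.+1, j < k.+1) residue_coord j (b i)) =
  (-1) ^+ (i0 + k) * g.[0] *
    \det (residue_mx (fun i => b (bump i0 i))).
Proof.
move=> bi0; rewrite (expand_det_row _ i0) (bigD1 ord_max) //= big1 => [|j ne_j].
  rewrite addr0 mxE bi0 residue_coord_mul ltnn /cofactor.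
  rewrite [RHS]mulrAC -[RHS]mulrC; congr (_ * (_ * \det _)).
  apply/matrixP => i j.
  by rewrite !mxE /residue_coord lift_max ltn_ord.
rewrite mxE bi0 residue_coord_mul ifT ?mul0r //.
by have := ltn_ord j; move: ne_j; rewrite -val_eqE /=; lia.
Qed.

Lemma det_hankel_weightX (L : {scalar {poly R}}) n (b : nat -> {poly R})
    i0 g :
  (forall i, (i <= k)%N -> monic_orthogonal L n (n + i) (b i)) ->
  (i0 <= k)%N -> b i0 = g * c ->
  \det (hankel n (fun m => L ('X^(m.+1) * c))) =
  (-1) ^+ (k.+1 * n + i0 + k) * \det (hankel n (fun m => L 'X^m)) * g.[0] *
    \det (residue_mx (fun i => b (bump i0 i))).
Proof.
move=> b_mon_orth le_i0k bi0.
have -> : \det (hankel n (fun m => L ('X^(m.+1) * c))) =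
    \det (hankel n (fun m => L ('X^m * ('X * c)))).
  by congr (\det _); apply/matrixP => i j; rewrite !mxE mulrA -exprSr.
rewrite -[LHS]mul1r -[X in X * _]det_residue_coord_Xn.
rewrite (det_hankel_christoffel monic_of_degree_mulX residue_coord_is_scalar
  residue_coord_mulX b_mon_orth).
rewrite (@det_residue_coord_mul _ (Ordinal (le_i0k : i0 < k.+1)%N) _ bi0).
by rewrite -addnA [in RHS]exprD -!mulrA; congr (_ * _); rewrite mulrCA.
Qed.

End ResidueCoordinates.

Lemma hankel_exponent_residue0 k m :
  (k.+1 ^ 2 * 'C(m.+1, 2) - k.+1 * m = 'C(k.+1 * m, 2) + m * 'C(k.+1, 2))%N.
Proof. by have := bin2S_double k; rewrite bin2M (binS m) bin1; nia. Qed.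

Lemma hankel_exponent_residue1 k m :
  (k.+1 ^ 2 * 'C(m.+1, 2) = 'C((k.+1 * m).+1, 2) + m * 'C(k.+1, 2))%N.
Proof.
have := bin2S_double k.
by rewrite (binS m) (binS (k.+1 * m)) bin2M !bin1; nia.
Qed.

Lemma hankel_exponent_residuek k m : (0 < k)%N ->
  (k.+1 ^ 2 * 'C(m.+1, 2) + (k ^ 2 - 1) * m.+1 =
   'C(k.+1 * m + k, 2) + 'C(k.+1, 2).-1 + m * 'C(k.+1, 2))%N.
Proof.
case: k => // k _; set n := (k.+2 * m + k.+1)%N.
have nSE : (k.+2 * m.+1 = n.+1)%N by rewrite /n; lia.
have pred_sqr : (k.+1 ^ 2 - 1 = k * k.+2)%N by lia.
have := bin2M k.+2 m.+1; rewrite nSE (binS n) bin1 pred_sqr.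
have := bin2S_double k.+1; have := congr1 (muln m.+1) (bin2S_double k.+1).
by rewrite /n; lia.
Qed.

Section ThreeStepHankel.
Variables (R : comNzRingType) (x y : R).

(* The sum of the step weights [1], [x + y] and [x * y]. *)
Local Notation sigma := ((1 + x) * (1 + y)).
Local Notation mu := (Pplus_total x y).

Definition cheb : nat -> {poly R} := lucasU ('X - (x + y)%:P) (x * y)%:P.

Lemma cheb0 : cheb 0 = 0. Proof. by []. Qed.

Lemma cheb1 : cheb 1 = 1. Proof. by []. Qed.

Lemma chebSS m : cheb m.+2 = ('X - (x + y)%:P) * cheb m.+1 - (x * y) *: cheb m.
Proof. by rewrite /cheb lucasUSS mul_polyC. Qed.

Lemma monic_of_degree_cheb m : monic_of_degree m (cheb m.+1).
Proof.
elim/ltn_ind: m => -[|[|m]] IHm; first exact: (monic_of_degreeXn R 0).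
  by rewrite chebSS cheb0 cheb1 scaler0 subr0 mulr1 monic_of_degreeXsubC.
rewrite chebSS -add1n monic_of_degreeD //.
  by rewrite monic_of_degreeM ?monic_of_degreeXsubC ?IHm.
rewrite size_polyN (leq_trans (size_scale_leq _ _)) //.
by have /andP[_ /eqP->] := IHm m (leqnSn _).
Qed.

Lemma size_cheb m : size (cheb m) = m.
Proof.
case: m => [|m]; first by rewrite cheb0 size_poly0.
by have /andP[_ /eqP] := monic_of_degree_cheb m.
Qed.

Definition path_functional : {poly R} -> R := moment_functional (mu^~ 0%N).

HB.instance Definition _ := GRing.Linear.on path_functional.

Local Notation L := path_functional.

Lemma path_functionalXn m : L 'X^m = mu m 0%N.
Proof. exact: moment_functionalXn. Qed.

Lemma path_functional_Xn_cheb m k : L ('X^m * cheb k.+1) = mu m k.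
Proof.
elim/ltn_ind: k m => -[|k] IHk m.
  by rewrite cheb1 mulr1 path_functionalXn.
rewrite chebSS mulrBr mulrA mulrBr -exprSr mulrBl -scalerAr.
rewrite -['X^m * _%:P]mulrC mul_polyC -scalerAl !linearB !linearZ /=.
rewrite !IHk // Pplus_totalS; case: k IHk => [|k] IHk.
  by rewrite cheb0 mulr0 linear0; ring.
by rewrite IHk; [ring | lia].
Qed.

Lemma path_functional_mul_cheb (f : {poly R}) a :
  (size f <= a)%N -> L (f * cheb a) = f.[sigma].
Proof.
case: a => [|a] le_fa.
  move: le_fa; rewrite leqn0 size_poly_eq0 => /eqP->.
  by rewrite mul0r linear0 horner0.
rewrite (horner_coef_wide _ le_fa) {1}(poly_sum_coefs le_fa).
rewrite big_distrl linear_sum.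
apply: eq_bigr => i _ /=; rewrite -scalerAl linearZ /=.
by rewrite path_functional_Xn_cheb Pplus_total_high // -ltnS.
Qed.

Lemma orthogonal_below_mul_cheb n (f : {poly R}) a :
  f.[sigma] = 0 -> (n + size f <= a.+1)%N -> orthogonal_below L n (f * cheb a).
Proof.
move=> f_root le_a j lt_jn; rewrite /= mulrA path_functional_mul_cheb.
  by rewrite hornerM f_root mulr0.
by rewrite (leq_trans (size_polyMleq _ _)) // size_polyXn; lia.
Qed.

Lemma monic_orthogonal_cheb_sub n l m : (n <= m <= l)%N ->
  monic_orthogonal L n l (cheb l.+1 - cheb m).
Proof.
move=> /andP[le_nm le_ml]; split.
  apply: monic_of_degreeD; first exact: monic_of_degree_cheb.
  by rewrite size_polyN size_cheb.
move=> j lt_jn; rewrite mulrBr linearB /= !path_functional_mul_cheb ?subrr //.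
all: by rewrite size_polyXn; lia.
Qed.

Lemma monic_orthogonal_XsubC_cheb n a : (n <= a)%N ->
  monic_orthogonal L n a.+1 (('X - sigma%:P) * cheb a.+1).
Proof.
move=> le_na; split.
  rewrite -add1n; apply: monic_of_degreeM; first exact: monic_of_degreeXsubC.
  exact: monic_of_degree_cheb.
apply: orthogonal_below_mul_cheb; first by rewrite hornerXsubC subrr.
by rewrite size_XsubC; lia.
Qed.

Lemma monic_orthogonal_X_XsubC_cheb n a : (n < a)%N ->
  monic_orthogonal L n a.+2 ('X * ('X - sigma%:P) * cheb a.+1).
Proof.
move=> lt_na; split.
  rewrite -[a.+2]add1n -mulrA.
  apply: monic_of_degreeM; first exact: (monic_of_degreeXn R 1).
  by have [] := monic_orthogonal_XsubC_cheb (ltnW lt_na).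
apply: orthogonal_below_mul_cheb.
  by rewrite hornerM hornerXsubC subrr mulr0.
by rewrite mulrC size_mulX ?polyXsubC_eq0 // size_XsubC; lia.
Qed.

Lemma det_hankel_height0 n : \det (hankel n (mu^~ 0%N)) = (x * y) ^+ 'C(n, 2).
Proof.
have -> : hankel n (mu^~ 0%N) = hankel n (fun m => L 'X^m).
  by apply/matrixP => i j; rewrite !mxE /= path_functionalXn.
rewrite (@det_hankel_orthogonal _ _ n (fun l => cheb l.+1 - cheb l))
  => [|l _]; last by apply: monic_orthogonal_cheb_sub; rewrite leqnn.
rewrite -bin2_sum big_mkord -prodrXr; apply: eq_bigr => l _.
rewrite mulrBr linearB /= path_functional_mul_cheb ?size_polyXn // hornerXn.
case: l => -[|l] _ /=; first by rewrite cheb0 mulr0 linear0 subr0.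
by rewrite path_functional_Xn_cheb Pplus_total_diag subKr.
Qed.

Definition cheb_quotient d : nat -> {poly R} :=
  lucasU (lucasV ('X - (x + y)%:P) (x * y)%:P d) ((x * y)%:P ^+ d).

Lemma cheb_mul d n : cheb (d * n) = cheb_quotient d n * cheb d.
Proof. exact: lucasU_mul. Qed.

Lemma horner0_cheb_quotient k m :
  (cheb_quotient k.+1 m).[0] = (-1) ^+ (k.+1 * m.+1) * Qpoly x y k m.
Proof.
case: m => [|m]; first by rewrite horner0 /Qpoly big_ord0 mulr0.
have eval0_p : horner_eval 0 (x * y)%:P = (-1) ^+ 2 * (x * y).
  by rewrite /horner_eval hornerC; ring.
have eval0_s : horner_eval 0 ('X - (x + y)%:P) = -1 * (x + y).
  by rewrite /horner_eval hornerXsubC; ring.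
rewrite -/(horner_eval 0 _) /cheb_quotient.
rewrite rmorph_lucasU rmorphXn rmorph_lucasV /= eval0_p eval0_s.
rewrite lucasV_homog lucasV_sum_prod exprMn exprAC exprMn lucasU_homog.
rewrite lucasU_sum_prod -exprM; congr (_ * _).
  by apply: eq_signr; rewrite !oddM /= negbK.
by apply: eq_bigr => j _; rewrite addn1 !exprM.
Qed.

Section ResiduesModCheb.
Variable k : nat.

Local Notation c := (cheb k.+1).

Lemma cheb_monic : c \is monic.
Proof. by case/andP: (monic_of_degree_cheb k). Qed.

Lemma rmodp_cheb_mul n : rmodp (cheb (k.+1 * n)) c = 0.
Proof. by rewrite cheb_mul rmodp_mull ?cheb_monic. Qed.

Lemma rmodp_cheb_small m : (m <= k)%N -> rmodp (cheb m) c = cheb m.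
Proof. by move=> le_mk; rewrite rmodp_small // !size_cheb. Qed.

Lemma rmodp_cheb_reflect n m : (m <= k.+1 * n)%N ->
  rmodp (cheb (k.+1 * n + m)) c =
  - (x * y) ^+ m *: rmodp (cheb (k.+1 * n - m)) c.
Proof.
move=> le_m.
have := lucasU_reflect ('X - (x + y)%:P) (x * y)%:P m (k.+1 * n - m).
rewrite -/cheb -addnA subnKC // addnC -rmorphXn mul_polyC cheb_mul mulrA.
move=> reflectE; apply/eqP; rewrite scaleNr -addr_eq0.
by rewrite -rmodpZ -?rmodpD ?cheb_monic // reflectE rmodp_mull ?cheb_monic.
Qed.

Lemma det_residue_mx_cheb_rev n :
  \det (residue_mx k c (fun i => cheb (k.+1 * n.+1 - i.+1))) =
  (-1) ^+ 'C(k, 2) *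
    \det (residue_mx k c (fun i => cheb (k.+1 * n + i.+1))).
Proof.
rewrite -(det_reverse_rows k
  (fun i j => (rmodp (cheb (k.+1 * n + i.+1)) c)`_j)).
congr (\det _); apply/matrixP => i j; rewrite !mxE; congr (rmodp (cheb _) _)`_j.
by have := ltn_ord i; lia.
Qed.

Lemma det_residue_mx_cheb n :
  \det (residue_mx k c (fun i => cheb (k.+1 * n + i.+1))) =
  (- (x * y)) ^+ (n * 'C(k.+1, 2)).
Proof.
elim: n => [|n IHn].
  rewrite -[RHS](@det_monic_coefs _ k (fun l => cheb l.+1)) => [|l _].
    congr (\det _); apply/matrixP => i j.
    by rewrite !mxE muln0 rmodp_cheb_small ?ltn_ord.
  exact: monic_of_degree_cheb.
transitivity (\det (\matrix_(i < k, j < k)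
    (- (x * y) ^+ i.+1 * (rmodp (cheb (k.+1 * n.+1 - i.+1)) c)`_j))).
  congr (\det _); apply/matrixP => i j; have := ltn_ord i => lt_ik.
  by rewrite !mxE rmodp_cheb_reflect ?coefZ // mulnS; lia.
rewrite (det_scale_rows k (fun i => - (x * y) ^+ i.+1)
  (fun i j => (rmodp (cheb (k.+1 * n.+1 - i.+1)) c)`_j)).
rewrite det_residue_mx_cheb_rev IHn prodrN card_ord prodrXr.
have -> : (\sum_(i < k) i.+1 = 'C(k.+1, 2))%N.
  by rewrite -bin2_sum big_mkord big_ord_recl.
have sgnE : (-1) ^+ 'C(k.+1, 2) = (-1) ^+ k * (-1) ^+ 'C(k, 2) :> R.
  by rewrite -exprD binS bin1 addnC.
by rewrite mulSn exprD [X in _ = X * _]exprNn sgnE; ring.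
Qed.

Local Notation hankel_total_det n := (\det (hankel n (fun m => mu m.+1 k))).

Lemma det_hankel_total n (b : nat -> {poly R}) i0 g :
  (forall i, (i <= k)%N -> monic_orthogonal L n (n + i) (b i)) ->
  (i0 <= k)%N -> b i0 = g * c ->
  hankel_total_det n =
  (-1) ^+ (k.+1 * n + i0 + k) * (x * y) ^+ 'C(n, 2) * g.[0] *
    \det (residue_mx k c (fun i => b (bump i0 i))).
Proof.
move=> b_mon_orth le_i0k bi0.
have -> : hankel n (fun m => mu m.+1 k) = hankel n (fun m => L ('X^(m.+1) * c)).
  by apply/matrixP => i j; rewrite !mxE path_functional_Xn_cheb.
rewrite (det_hankel_weightX (monic_of_degree_cheb k) b_mon_orth le_i0k bi0).
congr (_ * _ * _ * _); rewrite -det_hankel_height0; congr (\det _).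
by apply/matrixP => i j; rewrite !mxE /= path_functionalXn.
Qed.

Lemma det_hankel_total_residue0 m :
  hankel_total_det (k.+1 * m) =
  (-1) ^+ (m * 'C(k.+1, 2)) * (x * y) ^+ (k.+1 ^ 2 * 'C(m.+1, 2) - k.+1 * m)
  * (Qpoly x y k m.+1 + (-1) ^+ k * Qpoly x y k m).
Proof.
set n := (k.+1 * m)%N; pose b i := cheb (n + i).+1 - cheb n.
pose g := cheb_quotient k.+1 m.+1 - cheb_quotient k.+1 m.
have b_mon_orth i : (i <= k)%N -> monic_orthogonal L n (n + i) (b i).
  by move=> _; apply: monic_orthogonal_cheb_sub; rewrite leqnn leq_addr.
have bk : b k = g * c by rewrite /g mulrBl -!cheb_mul mulnSr addnS.
have g0 : g.[0] = (-1) ^+ n * (Qpoly x y k m.+1 + (-1) ^+ k * Qpoly x y k m).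
  have sgnSS : (-1) ^+ (k.+1 * m.+2) = (-1) ^+ n :> R.
    by apply: eq_signr; rewrite !oddM /= negbK.
  have sgnS : (-1) ^+ (k.+1 * m.+1) = - ((-1) ^+ n * (-1) ^+ k) :> R.
    rewrite -exprD -[RHS]mulN1r -exprS; apply: eq_signr.
    by rewrite /n /= !(oddD, oddM) /=; case: (odd k); case: (odd m).
  by rewrite hornerD hornerN !horner0_cheb_quotient sgnSS sgnS; ring.
have det_residues : \det (residue_mx k c (fun i => b (bump k i))) =
    (- (x * y)) ^+ (m * 'C(k.+1, 2)).
  rewrite -det_residue_mx_cheb; congr (\det _).
  apply/matrixP => i j; rewrite !mxE.
  have -> : bump k i = i := lift_max i.
  by rewrite rmodpB ?cheb_monic // rmodp_cheb_mul subr0 addnS.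
rewrite hankel_exponent_residue0 (det_hankel_total b_mon_orth (leqnn k) bk).
rewrite g0 det_residues.
transitivity ((-1) ^+ (k.+1 * n + k + k + n + m * 'C(k.+1, 2)) *
    (x * y) ^+ ('C(n, 2) + m * 'C(k.+1, 2)) *
    (Qpoly x y k m.+1 + (-1) ^+ k * Qpoly x y k m)).
  by rewrite (exprNn (x * y)) !exprD; ring.
congr (_ * _ * _); apply: eq_signr; rewrite /n !(oddD, oddM) /=.
by case: (odd k); case: (odd m).
Qed.

Lemma horner0_XsubC_cheb_quotient m :
  (('X - sigma%:P) * cheb_quotient k.+1 m.+1).[0] =
  - ((-1) ^+ (k.+1 * m) * ((1 + x) * (1 + y) * Qpoly x y k m.+1)).
Proof.
rewrite hornerM hornerXsubC horner0_cheb_quotient.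
rewrite (eq_signr R (a := k.+1 * m.+2) (b := k.+1 * m)) ?oddM /= ?negbK //.
by ring.
Qed.

Lemma det_hankel_total_residue1 m : (0 < k)%N ->
  hankel_total_det (k.+1 * m).+1 =
  (-1) ^+ (m * 'C(k.+1, 2)) * (x * y) ^+ (k.+1 ^ 2 * 'C(m.+1, 2))
  * (1 + x) * (1 + y) * Qpoly x y k m.+1.
Proof.
move=> k_gt0; set n := (k.+1 * m).+1.
have nkE : (n + k = k.+1 * m.+1)%N by rewrite /n; lia.
pose b i := if i == k then ('X - sigma%:P) * cheb (n + k)
            else cheb (n + i).+1 - cheb (n + i).
have b_mon_orth i : (i <= k)%N -> monic_orthogonal L n (n + i) (b i).
  move=> le_ik; rewrite /b; case: eqP => [->|_].
    rewrite -(prednK k_gt0) addnS.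
    by apply: monic_orthogonal_XsubC_cheb; rewrite leq_addr.
  by apply: monic_orthogonal_cheb_sub; rewrite leqnn leq_addr.
have bk : b k = ('X - sigma%:P) * cheb_quotient k.+1 m.+1 * c.
  by rewrite /b eqxx nkE cheb_mul mulrA.
have det_residues : \det (residue_mx k c (fun i => b (bump k i))) =
    (-1) ^+ k * (- (x * y)) ^+ (m * 'C(k.+1, 2)).
  rewrite -det_residue_mx_cheb.
  rewrite -(@det_telescope_rows _ k
    (fun i j => (rmodp (cheb (k.+1 * m + i.+1)) c)`_j)).
    congr (\det _); apply/matrixP => i j; rewrite !mxE.
    have -> : bump k i = i := lift_max i.
    rewrite /b ltn_eqF ?ltn_ord // rmodpB ?cheb_monic // coefB.
    by rewrite !addnS !addSn.
  by move=> j; rewrite -mulnSr rmodp_cheb_mul coef0.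
rewrite hankel_exponent_residue1 (det_hankel_total b_mon_orth (leqnn k) bk).
rewrite horner0_XsubC_cheb_quotient det_residues.
transitivity ((-1) ^+ (k.+1 * n + k + k + 1 + k.+1 * m + k + m * 'C(k.+1, 2)) *
    (x * y) ^+ ('C(n, 2) + m * 'C(k.+1, 2)) *
    (1 + x) * (1 + y) * Qpoly x y k m.+1).
  by rewrite (exprNn (x * y)) !exprD; ring.
congr (_ * _ * _ * _ * _); apply: eq_signr; rewrite /n !(oddD, oddM, oddS) /=.
by case: (odd k); case: (odd m).
Qed.

Lemma det_residue_mx_cheb_above m (n := (k.+1 * m + k)%N) : (0 < k)%N ->
  \det (residue_mx k c (fun i => if i == 0 then cheb n.+1 - cheb n
                                 else cheb (n.+1 + i.+1) - cheb n.+1)) =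
  (-1) ^+ k * (x * y) ^+ 'C(k.+1, 2).-1 *
    ((-1) ^+ 'C(k, 2) * (- (x * y)) ^+ (m * 'C(k.+1, 2))).
Proof.
move=> k_gt0; have nSE : n.+1 = (k.+1 * m.+1)%N by rewrite /n; lia.
pose e l := if l == 0 then 0 else l.+1.
have sum_e : (\sum_(l < k) e l = 'C(k.+1, 2).-1)%N.
  rewrite -bin2_sum big_mkord big_ord_recl; case: k k_gt0 => // k' _.
  by rewrite [in RHS]big_ord_recl big_ord_recl.
rewrite -sum_e -prodrXr -[in (-1) ^+ k](card_ord k) -prodrN.
rewrite -det_residue_mx_cheb -det_residue_mx_cheb_rev.
rewrite -(det_scale_rows k (fun l => - (x * y) ^+ e l)
  (fun i j => (rmodp (cheb (k.+1 * m.+1 - i.+1)) c)`_j)).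
congr (\det _); apply/matrixP => i j; rewrite !mxE /e nSE.
case: eqP => [->|_].
  rewrite -{2}nSE subn1 rmodpB ?cheb_monic // rmodp_cheb_mul sub0r.
  by rewrite coefN mulN1r.
rewrite rmodpB ?cheb_monic // rmodp_cheb_mul subr0 rmodp_cheb_reflect ?coefZ //.
by have := ltn_ord i; lia.
Qed.

Lemma det_hankel_total_residuek m : (0 < k)%N ->
  hankel_total_det (k.+1 * m + k) =
  (-1) ^+ (m.+1 * 'C(k.+1, 2) + k)
  * (x * y) ^+ (k.+1 ^ 2 * 'C(m.+1, 2) + (k ^ 2 - 1) * m.+1)
  * (1 + x) * (1 + y) * Qpoly x y k m.+1.
Proof.
move=> k_gt0; set n := (k.+1 * m + k)%N.
have nSE : (n.+1 = k.+1 * m.+1)%N by rewrite /n; lia.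
pose b i := if i == 0 then cheb n.+1 - cheb n
            else if i == 1 then ('X - sigma%:P) * cheb n.+1
            else cheb (n.+1 + i) - cheb n.+1.
have b_mon_orth i : (i <= k)%N -> monic_orthogonal L n (n + i) (b i).
  move=> le_ik; rewrite /b; case: eqP => [->|/eqP i_neq0].
    by rewrite addn0; apply: monic_orthogonal_cheb_sub; rewrite leqnn.
  case: eqP => [->|_].
    by rewrite addn1; apply: monic_orthogonal_XsubC_cheb.
  by rewrite addSn; apply: monic_orthogonal_cheb_sub; lia.
have b1 : b 1 = ('X - sigma%:P) * cheb_quotient k.+1 m.+1 * c.
  by rewrite /b nSE cheb_mul mulrA.
rewrite (det_hankel_total b_mon_orth k_gt0 b1) horner0_XsubC_cheb_quotient.
have -> : residue_mx k c (fun i => b (bump 1 i)) =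
    residue_mx k c (fun i => if i == 0 then cheb n.+1 - cheb n
                             else cheb (n.+1 + i.+1) - cheb n.+1).
  by apply/matrixP => i j; rewrite !mxE; case: (nat_of_ord i).
rewrite det_residue_mx_cheb_above // hankel_exponent_residuek //.
transitivity ((-1) ^+ (k.+1 * n + 1 + k + 1 + k.+1 * m + k + 'C(k, 2)
                       + m * 'C(k.+1, 2)) *
    (x * y) ^+ ('C(n, 2) + 'C(k.+1, 2).-1 + m * 'C(k.+1, 2)) *
    (1 + x) * (1 + y) * Qpoly x y k m.+1).
  by rewrite (exprNn (x * y)) !exprD; ring.
congr (_ * _ * _ * _ * _); apply: eq_signr.
rewrite (binS k) bin1 /n !(oddD, oddM, oddS) /=.
by case: (odd k); case: (odd m); case: (odd 'C(k, 2)).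
Qed.

Lemma det_hankel_total_eq0 m r : (1 < r < k)%N ->
  hankel_total_det (k.+1 * m + r) = 0.
Proof.
move=> /andP[r_gt1 lt_rk]; set n := (k.+1 * m + r)%N; pose i0 := (k.+2 - r)%N.
pose b i := if i == i0 then 'X * ('X - sigma%:P) * cheb (k.+1 * m.+1)
            else cheb (n + i).+1 - cheb (n + i).
pose g := 'X * ('X - sigma%:P) * cheb_quotient k.+1 m.+1.
have b_mon_orth i : (i <= k)%N -> monic_orthogonal L n (n + i) (b i).
  move=> le_ik; rewrite /b; case: eqP => [->|_].
    have -> : (n + i0 = (k.+1 * m + k).+2)%N by rewrite /n /i0; lia.
    rewrite mulnS addSn addnC; apply: monic_orthogonal_X_XsubC_cheb.
    by rewrite /n; lia.
  by apply: monic_orthogonal_cheb_sub; rewrite leqnn leq_addr.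
have bi0 : b i0 = g * c by rewrite /b eqxx cheb_mul mulrA.
have le_i0k : (i0 <= k)%N by rewrite /i0; lia.
rewrite (det_hankel_total b_mon_orth le_i0k bi0).
by rewrite /g !hornerM hornerX !mul0r mulr0 mul0r.
Qed.

End ResiduesModCheb.

End ThreeStepHankel.

Lemma hankel_detE n k :
  hankel_det n k = \det (hankel n (fun m => Pplus_total xv yv m.+1 k)).
Proof.
by congr (\det _); apply/matrixP => i j; rewrite !mxE addn1.
Qed.

Theorem theorem4 (n k : nat) : (0 < n)%N ->
  [/\ (forall n1 : nat, n = ((k + 1) * n1)%N ->
         hankel_det n k =
           (-1) ^+ (n1 * 'C(k + 1, 2)) * (xv * yv) ^+ ((k + 1) ^ 2 * 'C(n1 + 1, 2) - n)
           * (Qpoly xv yv k (n1 + 1) + (-1) ^+ k * Qpoly xv yv k n1)),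
      (1 <= k)%N -> forall n1 : nat, n = ((k + 1) * n1 + 1)%N ->
         hankel_det n k =
           (-1) ^+ (n1 * 'C(k + 1, 2)) * (xv * yv) ^+ ((k + 1) ^ 2 * 'C(n1 + 1, 2))
           * (1 + xv) * (1 + yv) * Qpoly xv yv k (n1 + 1),
      (2 <= k)%N -> forall n1 : nat, n = ((k + 1) * n1 + k)%N ->
         hankel_det n k =
           (-1) ^+ ((n1 + 1) * 'C(k + 1, 2) + k)
           * (xv * yv) ^+ ((k + 1) ^ 2 * 'C(n1 + 1, 2) + (k ^ 2 - 1) * (n1 + 1))
           * (1 + xv) * (1 + yv) * Qpoly xv yv k (n1 + 1)
    & [&& n %% (k + 1) != 0, n %% (k + 1) != 1 & n %% (k + 1) != k]%N ->
         hankel_det n k = 0].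
Proof.
move=> _; rewrite hankel_detE addn1; split.
- by move=> m ->; rewrite addn1 det_hankel_total_residue0.
- by move=> k_gt0 m ->; rewrite !addn1 det_hankel_total_residue1.
- by move=> /ltnW k_gt0 m ->; rewrite addn1 det_hankel_total_residuek.
move=> /and3P[neq0 neq1 neqk].
rewrite (divn_eq n k.+1) mulnC det_hankel_total_eq0 //.
by have := ltn_pmod n (ltn0Sn k); lia.
Qed.
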